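(* Let $A\subseteq\mathbb{N}$ and let $k\in\mathbb{N}$. The following are equivalent: (1) There exists an infinite set $B\subseteq\mathbb{N}$ such that $B^{k\oplus}\subseteq A$. (2) There exists a non-principal ultrafilter $\mathcal{U}$ on $\mathbb{N}$ with $A\in\mathcal{U}^{k\oplus}$.
   Context: $\mathbb{N}=\{1,2,3,\ldots\}$. For an infinite set $B\subseteq\mathbb{N}$, $B^{k\oplus}=\{b_1+\cdots+b_k\mid b_1,\ldots,b_k\in B\text{ distinct}\}=\{\sum_{b\in F}b\mid F\subset B,\ |F|=k\}$. The pseudo-sum of ultrafilters $\mathcal{U},\mathcal{V}$ on $\mathbb{N}$ is the ultrafilter $\mathcal{U}\oplus\mathcal{V}$ on $\mathbb{N}$ defined by $A\in\mathcal{U}\oplus\mathcal{V}\iff\{n\in\mathbb{N}\mid A-n\in\mathcal{V}\}\in\mathcal{U}$, where $A-n=\{m\in\mathbb{N}\mid m+n\in A\}$. This operation is associative, and $\mathcal{U}^{k\oplus}=\mathcal{U}\oplus\cdots\oplus\mathcal{U}$ ($k$ times). *)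

(* Defs.v *)
From mathcomp Require Import all_boot finmap.
From mathcomp Require Import boolp classical_sets functions cardinality filter.

Set Implicit Arguments.
Unset Strict Implicit.
Unset Printing Implicit Defensive.

Local Open Scope classical_set_scope.

(* The natural numbers here start at 1; as 0 is excluded
   from the type itself, no set or ultrafilter can involve it. *)
Definition posn := {n : nat | (0 < n)%N}.

Lemma addp_subproof (m n : posn) : (0 < val m + val n)%N.
Proof. by rewrite addn_gt0 (valP m). Qed.

Definition addp (m n : posn) : posn := exist _ (val m + val n)%N (addp_subproof m n).

(* Sums are computed in nat, as posn has no neutral element for addition. *)
Definition ksums (k : posn) (B : set posn) : set posn :=
  [set n | exists F : {fset posn},
    [/\ [set` F] `<=` B, #|` F| = val k & val n = (\sum_(b <- F) val b)%N]].

Definition shift (A : set posn) (n : posn) : set posn := [set m | A (addp m n)].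

Definition pseudo_sum (U V : set_system posn) : set_system posn :=
  [set A | U [set n | V (shift A n)]].

(* The k-fold pseudo-sum, bracketed to the right; pseudo_sum is associative. *)
Definition pseudo_pow (k : posn) (U : set_system posn) : set_system posn :=
  iter (val k).-1 (pseudo_sum U) U.

Definition nonprincipal (U : set_system posn) : Prop :=
  forall n : posn, U <> principal_filter n.

(* Main.v *)
Require Import Defs.
From mathcomp Require Import all_boot finmap.
From mathcomp Require Import boolp classical_sets functions cardinality filter.

(** A [k]-fold pseudo-sum is [k] nested quantifiers over one ultrafilter: [A]
    belongs to it when for [U]-many [n_1], for [U]-many [n_2], ..., for
    [U]-many [n_k], the number [n_1 + ... + n_k] is in [A]
    ([pseudo_pow_sum_near]).  Both implications are then about building a set
    of size [k] one element at a time.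

    If all sums of [k] distinct elements of the infinite set [B] are in [A],
    take an ultrafilter [U] containing [B] minus every finite set.  Finitely
    many elements of [B] having been chosen, [U]-many [n] are further elements
    of [B], so all the quantifiers can be passed ([sum_near_subset_sums]).

    Conversely, call a finite set [F] good ([completable]) when, for each of its
    subsets [E] with at most [k] elements, the sum of [E] still leads to [A]
    after [k - |E|] more quantifiers.  Goodness of [F] is finitely many
    conditions, each of which [U]-many new elements preserve, and a nonprincipal
    ultrafilter leaves a common new element outside [F] ([completable_extend]).
    Adding such elements forever yields an infinite set [B] whose finite subsets
    are contained in good sets ([infinite_of_extension]), and for subsets of
    size [k] goodness says that the sum is in [A]. *)

Local Open Scope classical_set_scope.

(** * Pseudo-powers as nested quantifiers *)

(** The accumulator [s] is a natural number, so that the nesting can start from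
    the empty sum, and [A] accordingly is a set of natural numbers. *)
Fixpoint sum_near (U : set_system posn) (A : set nat) (j s : nat) : Prop :=
  if j is i.+1 then U [set n : posn | sum_near U A i (s + val n)] else A s.

(** Unfolding one pseudo-sum shifts the set, which amounts to adding one summand
    to the accumulator. *)
Lemma iter_pseudo_sum_near (U : set_system posn) (A : set nat) (j s : nat) :
  iter j (pseudo_sum U) U [set m | A (s + val m)] = sum_near U A j.+1 s.
Proof.
elim: j s => [|j IHj] s //=.
congr (U _); apply/funext => n /=; rewrite -[RHS]IHj.
congr (iter _ _ _ _); apply/funext => m /=; congr A.
by rewrite addnA addnAC.
Qed.

Lemma pseudo_pow_sum_near (U : set_system posn) (A : set posn) (k : posn) :
  pseudo_pow k U A = sum_near U (val @` A) (val k) 0.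
Proof.
rewrite -[in RHS](prednK (valP k)) -iter_pseudo_sum_near /pseudo_pow.
congr (iter _ _ _ _); apply/seteqP; split => m /= => [Am|[a Aa /val_inj <-//]].
by exists m.
Qed.

(** * Ultrafilters and finite sets *)

(** The ultrafilter extends the trace on [B] of the cofinite filter, which is
    proper because [B] is infinite. *)
Lemma infinite_ultrafilter {T : Type} {B : set T} : infinite_set B ->
  exists U : set_system T,
    UltraFilter U /\ forall E, finite_set E -> U (B `\` E).
Proof.
move=> infB.
have infT : infinite_set [set: T] by apply: sub_infinite_set infB.
have frechetF := @frechet_properfilter T infT.
have properF : ProperFilter (within B (@frechet_filter T)).
  apply: Build_ProperFilter => fin0; apply: infB; apply: sub_finite_set fin0.
  by move=> x Bx /(_ Bx).
have [U [ultraU subU]] := ultraFilterLemma properF.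
exists U; split=> // E finE; apply: subU.
by apply: sub_finite_set finE => x /= nBE; apply: contrapT => nEx; apply: nBE.
Qed.

(** If [[set n]] were in [U], every member of [U] would meet it, hence contain
    [n], and [U] would be principal. *)
Lemma nonprincipal_setC1 {U : set_system posn} {FU : UltraFilter U}
  (n : posn) : nonprincipal U -> U (~` [set n]).
Proof.
move=> npU; have [Un|//] := in_ultra_setVsetC [set n] FU.
case: (npU n); apply/seteqP; split=> [X UX|X /principal_filterP Xn].
  by apply/principal_filterP; have [_ [/[swap]-> ]] := filter_ex (filterI UX Un).
by apply: filterS Un => _ ->.
Qed.

Lemma nonprincipal_notin {U : set_system posn} {FU : UltraFilter U}
  (F : {fset posn}) : nonprincipal U -> U [set n | n \notin F].
Proof.
move=> npU; have UC n : n \in F -> U (~` [set n]).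
  by move=> _; exact: nonprincipal_setC1.
by apply: filterS (filter_bigI _ UC) => n nF; apply/negP => /nF; exact.
Qed.

(** * From a set of sums to an ultrafilter *)

(** The set [F] collects the elements already chosen; those still to come are
    taken outside [F], which keeps the summands distinct. *)
Lemma sum_near_subset_sums {U : set_system posn} {FU : Filter U}
    {A : set nat} {B : set posn} {k : nat} :
  (forall E, finite_set E -> U (B `\` E)) ->
  (forall F : {fset posn}, [set` F] `<=` B -> #|` F| = k ->
    A (\sum_(b <- F) val b)) ->
  forall (j : nat) (F : {fset posn}), [set` F] `<=` B -> #|` F| + j = k ->
    sum_near U A j (\sum_(b <- F) val b).
Proof.
move=> UB sumsA; elim=> [|j IHj] F FB cardF /=.
  by apply: sumsA => //; rewrite -cardF addn0.
apply: filterS (UB _ (finite_fset F)) => n [Bn /negP nF] /=.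
rewrite addnC -(big_fsetU1 _ (fun b : posn => val b) nF) /=; apply: IHj => [b|].
  by rewrite /= in_fset1U => /predU1P[->|/FB].
by rewrite cardfsU1 nF add1n addSnnS.
Qed.

(** * From an ultrafilter to a set of sums *)

(** Elements are added one by one; finite subsets of the union of the resulting
    chain appear at a finite stage. *)
Lemma infinite_of_extension {T : choiceType} {good : {fset T} -> Prop} :
  good fset0 ->
  (forall F, good F -> exists2 b, b \notin F & good (b |` F)%fset) ->
  exists B : set T, infinite_set B /\
    forall E : {fset T}, [set` E] `<=` B ->
      exists2 F, good F & (E `<=` F)%fset.
Proof.
move=> good0 goodS.
have /choice[next nextP] (F : {fset T}) :
    exists G : {fset T}, good F -> (F `<` G)%fset /\ good G.
  have [/goodS[b bF gbF]|ngF] := pselect (good F); last by exists F.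
  by exists (b |` F)%fset => _; rewrite fproperUr // fsub1set.
pose C n := iter n next fset0.
have goodC n : good (C n) by elim: n => [|n IHn] //; case: (nextP _ IHn).
have ltC n : (C n `<` C n.+1)%fset by case: (nextP _ (goodC n)).
have leC m n : m <= n -> (C m `<=` C n)%fset.
  move/subnK<-; elim: (n - m) => [|i IHi] //.
  exact: fsubset_trans IHi (fproper_sub (ltC _)).
pose B := [set b | exists n, b \in C n].
have finB (E : {fset T}) : [set` E] `<=` B -> exists n, (E `<=` C n)%fset.
  elim/fset1U_rect: E => [|b E _ IHE] EB; first by exists 0; rewrite fsub0set.
  have [n bCn] : B b by apply: EB; rewrite /= in_fset1U eqxx.
  have [m ECm] : exists m, (E `<=` C m)%fset.
    by apply: IHE => x xE; apply: EB; rewrite /= in_fset1U xE orbT.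
  exists (maxn n m); rewrite fsubUset fsub1set.
  rewrite (fsubset_trans ECm (leC _ _ (leq_maxr _ _))) andbT.
  exact: (fsubsetP (leC _ _ (leq_maxl _ _))).
exists B; split=> [/finite_fsetP[E BE]|E /finB[n ECn]]; last by exists (C n).
have [n ECn] : exists n, (E `<=` C n)%fset by apply: finB; rewrite BE.
have := ltC n; rewrite fproperE => /andP[_ /fsubsetPn[b bC /negP]]; apply.
by apply: (fsubsetP ECn); have : B b by [exists n.+1]; rewrite BE.
Qed.

(** The bound [#|` E| <= k] makes the subtraction exact; the case of equality
    puts the sum of [E] in [A]. *)
Definition completable (U : set_system posn) (A : set nat) (k : nat)
    (F : {fset posn}) : Prop :=
  forall E : {fset posn}, (E `<=` F)%fset -> #|` E| <= k ->
    sum_near U A (k - #|` E|) (\sum_(b <- E) val b).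

(** A subset of [b |` F] either avoids [b], and is covered by the hypothesis on
    [F], or is [b |` E] with [E] contained in [F].  In the second case the
    condition holds for [U]-many [b], since it strips the outermost quantifier
    off the condition known for [E]; there are finitely many such [E]. *)
Lemma completable_extend {U : set_system posn} {FU : UltraFilter U}
    {A : set nat} {k : nat} {F : {fset posn}} :
  nonprincipal U -> completable U A k F ->
  exists2 b, b \notin F & completable U A k (b |` F)%fset.
Proof.
move=> npU complF.
pose P (E : {fset posn}) : set posn := [set n | #|` E| < k ->
  sum_near U A (k - #|` E|.+1) (\sum_(b <- E) val b + val n)].
have UP : forall E, E \in fpowerset F -> U (P E).
  move=> E; rewrite fpowersetE => EF.
  have [Ek|kE] := ltnP #|` E| k.
    have := complF E EF (ltnW Ek); rewrite -subnSK //=.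
    by apply: filterS => n Un _.
  by apply: filterS filterT => n _; rewrite /P /= ltnNge kE.
have [b [bP bF]] := filter_ex (filterI (filter_bigI _ UP)
  (nonprincipal_notin F npU)).
exists b => // E EbF Ek.
have [bE|bE] := boolP (b \in E); last first.
  by apply: complF => //; move: EbF; rewrite -fsubDset mem_fsetD1.
have cardE : #|` E| = #|` (E `\ b)%fset|.+1 by rewrite (cardfsD1 b) bE.
rewrite cardE (big_fsetD1 b) //= addnC; apply: (bP (E `\ b)%fset).
  by rewrite /= fpowersetE fsubDset.
by rewrite -cardE.
Qed.

Theorem proposition6p7 (A : set posn) (k : posn) :
  (exists B : set posn, infinite_set B /\ ksums k B `<=` A) <->
  (exists U : set_system posn,
    [/\ UltraFilter U, nonprincipal U & pseudo_pow k U A]).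
Proof.
split=> [[B [infB sumsA]]|[U [ultraU npU]]].
  have [U [ultraU UB]] := infinite_ultrafilter infB.
  exists U; split=> // [n Un|].
    have := UB _ (finite_set1 n); rewrite Un => /principal_filterP[_].
    exact.
  have sum0 : \sum_(b <- (fset0 : {fset posn})) val b = 0.
    exact: big_seq_fset0.
  rewrite pseudo_pow_sum_near -[X in sum_near _ _ _ X]sum0.
  apply: (sum_near_subset_sums (k := val k) UB); first last.
  - by rewrite cardfs0.
  - by move=> b; rewrite /= inE.
  move=> F FB cardF.
  (* A sum over a nonempty set is positive, so it is the value of a [posn]. *)
  have sum_gt0 : 0 < \sum_(b <- F) val b.
    have [b bF] : exists b, b \in F.
      by apply/fset0Pn; rewrite -cardfs_gt0 cardF; exact: valP.
    by rewrite (big_fsetD1 b) //= addn_gt0 (valP b).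
  by exists (Sub _ sum_gt0) => //; apply: sumsA; exists F.
rewrite pseudo_pow_sum_near => UA.
have compl0 : completable U (val @` A) (val k) fset0.
  move=> E; rewrite fsubset0 => /eqP-> _.
  by rewrite cardfs0 subn0 big_seq_fset0.
have [B [infB goodB]] := infinite_of_extension compl0
  (fun F => completable_extend npU).
exists B; split=> // n [E [EB cardE sumE]].
have [F complF EF] := goodB E EB.
have := complF E EF; rewrite cardE subnn -sumE => /(_ (leqnn _)).
by case=> a Aa /val_inj <-.
Qed.
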